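(* (1) Fix $0<\alpha\le1$. For all $\theta<\pi$ sufficiently close to $\pi$, $$C^L(\alpha,\theta)\ge\frac{1+\alpha^2-2\alpha\cos\theta}{8\sqrt{\alpha\sin\theta}},$$ and consequently $C^L(\alpha,\theta)\to\infty$ as $\theta\to\pi$. (2) For all $0<\alpha\le 1$, $$C^L\!\left(\alpha,\frac{\pi}{2}\right)\ge\frac{\alpha^2+1}{8\sqrt{\alpha}},$$ and consequently $C^L(\alpha,\frac{\pi}{2})\to\infty$ as $\alpha\to0$.
   Context: For $0<\alpha\le 1$ and $\cos^{-1}(\alpha/2)\le\theta<\pi$, $K_{\alpha,\theta}$ denotes the (closed) triangle with vertices $p_1=(0,0)$, $p_2=(1,0)$, $p_3=(\alpha\cos\theta,\alpha\sin\theta)$. For a triangle $K$ and $u\in H^2(K)$, $\Pi^L u$ is the affine function on $K$ agreeing with $u$ at the three vertices of $K$. $\|\cdot\|_{\infty,K}$ is the $L^\infty(K)$-norm and $|u|_{2,K}^2=\int_K (u_{xx}^2+u_{xy}^2+u_{yx}^2+u_{yy}^2)\,dK$. The optimal interpolation error constant is $$C^L(\alpha,\theta):=\sup_{u\in H^2(K_{\alpha,\theta}),\ |u|_{2,K_{\alpha,\theta}}\ne 0}\frac{\|u-\Pi^L u\|_{\infty,K_{\alpha,\theta}}}{|u|_{2,K_{\alpha,\theta}}}.$$ *)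

(* Defs.v *)
From HB Require Import structures.
From mathcomp Require Import all_boot all_order all_algebra.
From mathcomp Require Import all_classical all_reals all_analysis.

Set Implicit Arguments.
Unset Strict Implicit.
Unset Printing Implicit Defensive.

Import Order.TTheory GRing.Theory Num.Theory.
Import numFieldNormedType.Exports.

Local Open Scope classical_set_scope.
Local Open Scope ring_scope.

Section Sobolev.
Variable R : realType.
Local Notation plane := (R * R)%type.

Definition area : {measure set (measurableTypeR R * measurableTypeR R) -> \bar R}
  := (@lebesgue_measure R \x @lebesgue_measure R)%E.

Definition axis (i : 'I_2) : plane := ((i == 0)%:R, (i == 1)%:R).

(* The words over {x, y} of length two are kept distinct, so that both mixed
   derivatives xy and yx are counted in [seminorm2]. *)
Definition partial (s : seq 'I_2) (f : plane -> R) : plane -> R :=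
  foldr (fun i g => 'D_(axis i) g) f s.

Definition smooth (f : plane -> R) : Prop := forall s : seq 'I_2,
  continuous (partial s f) /\
  forall (i : 'I_2) (p : plane), derivable (partial s f) p (axis i).

Definition test_function (U : set plane) (phi : plane -> R) : Prop :=
  smooth phi /\
  let S := closure [set p | phi p != 0] in compact S /\ S `<=` U.

Definition L2 (K : set plane) (f : plane -> R) : Prop :=
  (f \_ K : measurableTypeR R * measurableTypeR R -> R) \in Lfun area 2%:E.

Definition weak_partial (K : set plane) (s : seq 'I_2) (u g : plane -> R)
    : Prop :=
  forall phi : plane -> R, test_function K° phi ->
    (\int[area]_(p in K) (u p * partial s phi p) =
     (-1) ^+ size s * \int[area]_(p in K) (g p * phi p))%R.

Definition in_H2 (K : set plane) (u : plane -> R) : Prop :=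
  L2 K u /\ forall s : seq 'I_2, (size s <= 2)%N ->
    exists2 g : plane -> R, L2 K g & weak_partial K s u g.

(* Weak derivatives are unique almost everywhere on K, so [H] is determined by
   [u] up to a null set and [seminorm2 K H] depends only on [u]. *)
Definition weak_hessian (K : set plane) (u : plane -> R)
    (H : 'I_2 -> 'I_2 -> plane -> R) : Prop :=
  forall i j : 'I_2, L2 K (H i j) /\ weak_partial K [:: i; j] u (H i j).

Definition seminorm2 (K : set plane) (H : 'I_2 -> 'I_2 -> plane -> R) : R :=
  Num.sqrt (\int[area]_(p in K) (\sum_i \sum_j H i j p ^+ 2))%R.

Definition norm_oo (K : set plane) (f : plane -> R) : \bar R :=
  Lnorm area +oo%E (EFin \o f \_ K).

End Sobolev.

Section Interpolation.
Variable R : realType.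
Local Notation plane := (R * R)%type.

Definition vertex (alpha theta : R) (k : 'I_3) : plane :=
  [:: (0, 0); (1, 0); (alpha * cos theta, alpha * sin theta)]`_k.

Definition triangle (alpha theta : R) : set plane :=
  [set p | exists w : 'I_3 -> R, [/\ forall k, 0 <= w k, \sum_k w k = 1 &
    p = \sum_k w k *: vertex alpha theta k]].

Definition affine_fun (l : plane -> R) : Prop :=
  exists a b c : R, forall p, l p = a + b * p.1 + c * p.2.

(* The affine function is uniquely determined as soon as the triangle is
   nondegenerate, that is alpha * sin theta != 0. *)
Definition interp (alpha theta : R) (u : plane -> R) : plane -> R :=
  get [set l | affine_fun l /\
    forall k, l (vertex alpha theta k) = u (vertex alpha theta k)].

(* An element of H^2(K) is represented by its continuous representative, given
   by the Sobolev embedding of H^2(K) in C(K); this is what gives a meaning to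
   its values at the vertices. The supremum is taken in the extended reals. *)
Definition CL (alpha theta : R) : \bar R :=
  let K := triangle alpha theta in
  ereal_sup [set r | exists (u : plane -> R) (H : 'I_2 -> 'I_2 -> plane -> R),
    [/\ in_H2 K u, {within K, continuous u}, weak_hessian K u H,
        seminorm2 K H != 0%R &
        r = norm_oo K (u \- interp alpha theta u)%R / (seminorm2 K H)%:E]%E].

End Interpolation.

(* Main.v *)
Require Import Defs.
From HB Require Import structures.
From mathcomp Require Import all_boot all_order all_algebra.
From mathcomp Require Import all_classical all_reals all_analysis.
From mathcomp Require Import measurable_realfun ess_sup_inf.
From mathcomp Require Import ring lra.

Set Implicit Arguments.
Unset Strict Implicit.
Unset Printing Implicit Defensive.

Import Order.TTheory GRing.Theory Num.Theory.
Import numFieldNormedType.Exports.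

Local Open Scope classical_set_scope.
Local Open Scope ring_scope.

(** Both lower bounds come from one explicit function, u = x^2 + y^2.
Its Hessian is twice the identity, so |u|_2^2 is 8 times the area
alpha sin theta / 2 of the triangle, that is |u|_2 = 2 sqrt (alpha sin theta)
([seminorm2_normsq]).  At the midpoint m of an edge of length L, an
affine function takes the mean of its two end values, and the parallelogram
identity gives u(m) - (Pi u)(m) = - L^2 / 4 ([interp_error_midpoint]).  For the
edge opposite to the origin, L^2 = 1 + alpha^2 - 2 alpha cos theta by the law
of cosines, and the quotient of the two quantities is the announced bound
([CL_ge]), for every alpha > 0 and theta with sin theta > 0.  Both divergences
follow, since L^2 is eventually at least 1 while alpha sin theta tends to 0
([cvge_blowup]).

The rest justifies that u is an admissible competitor and that the pointwise
value at m counts.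

- Classical partial derivatives of a smooth function are weak derivatives on a
  compact set ([smooth_weak_partial]): for w smooth with compact support, the
  integral of each first partial derivative vanishes, by Fubini and the
  fundamental theorem of calculus on lines ([integral_partial_compact]); this is
  applied to the product of the function with a test function.
- The point m is on the boundary of the triangle, and the essential supremum
  ignores null sets; but by continuity the error is close to its value at m on
  a nonempty open subset of the interior, which has positive area
  ([norm_oo_ge]).
- The area is computed by integrating the lengths of the horizontal sections
  ([triangle_area]). *)

(** ** Borel sets and continuous functions of the plane *)

(** The plane with its product sigma-algebra, as opposed to the normed space
[R * R]. *)
Notation mplane R := (measurableTypeR R * measurableTypeR R)%type.

(** An open set is the union of the open rectangles with rational corners that
it contains, and these are countably many. *)
Lemma open_measurable_plane (R : realType) (U : set (R * R)) :
  open U -> measurable (U : set (mplane R)).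
Proof.
move=> oU.
pose box a b c d : set (R * R) := `]ratr a, ratr b[ `*` `]ratr c, ratr d[.
pose F (q : (rat * rat) * (rat * rat)) : set (R * R) :=
  if `[< box q.1.1 q.1.2 q.2.1 q.2.2 `<=` U >]
  then box q.1.1 q.1.2 q.2.1 q.2.2 else set0.
have -> : U = \bigcup_q F q.
  apply/seteqP; split => [p Up|p [q _]]; last first.
    by rewrite /F; case: asboolP => // qU; exact: qU.
  move: oU; rewrite openE => /(_ p Up)/nbhs_ballP[e /= e0 eU].
  have [a] : exists a, (ratr a : R) \in `]p.1 - e, p.1[.
    by apply: rat_in_itvoo; rewrite ltrBlDr ltrDl.
  have [b] : exists b, (ratr b : R) \in `]p.1, p.1 + e[.
    by apply: rat_in_itvoo; rewrite ltrDl.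
  have [c] : exists c, (ratr c : R) \in `]p.2 - e, p.2[.
    by apply: rat_in_itvoo; rewrite ltrBlDr ltrDl.
  have [d] : exists d, (ratr d : R) \in `]p.2, p.2 + e[.
    by apply: rat_in_itvoo; rewrite ltrDl.
  rewrite !in_itv/= => /andP[d1 d2] /andP[c1 c2] /andP[b1 b2] /andP[a1 a2].
  exists ((a, b), (c, d)) => //; rewrite /F /=; case: asboolP; last first.
    case => q [] /=; rewrite !in_itv/= => /andP[x1 x2] /andP[y1 y2].
    by apply: eU; split => /=; rewrite /ball/= ltr_distlC; lra.
  by move=> _; split => /=; rewrite in_itv/=; lra.
apply: countable_bigcupT_measurable => // q; rewrite /F; case: ifP => // _.
exact: (measurableX (measurable_itv _) (measurable_itv _)).
Qed.

Lemma continuous_measurable_plane (R : realType) (f : R * R -> R) :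
  continuous f -> measurable_fun setT (f : mplane R -> measurableTypeR R).
Proof.
move=> /continuousP cf.
apply: (measurability _ (measurable_realfun.RGenOpens.measurableE R)).
move=> _ [_ [a [b ->] <-]]; rewrite setTI; apply: open_measurable_plane.
exact/cf/interval_open.
Qed.

Lemma compact_measurable_plane (R : realType) (K : set (R * R)) :
  compact K -> measurable (K : set (mplane R)).
Proof.
move/(compact_closed (@norm_hausdorff _ _))/closed_openC.
by move/open_measurable_plane/measurableC; rewrite setCK.
Qed.

Lemma compact_in_square (R : realType) (K : set (R * R)) : compact K ->
  exists2 M : R, 0 < M & forall p, K p -> `|p.1| < M /\ `|p.2| < M.
Proof.
move=> /compact_bounded[M [_ /(_ (`|M| + 1))]].
have -> : M < `|M| + 1 by rewrite (le_lt_trans (ler_norm _))// ltrDl.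
move=> /(_ isT) KM; exists (`|M| + 2); first by rewrite ltr_wpDl.
move=> p /KM/=; rewrite prod_normE ge_max => /andP[p1 p2].
by split; [move: p1|move: p2] => /le_lt_trans; apply; rewrite ltrD2l; lra.
Qed.

Lemma compact_area_lty (R : realType) (K : set (R * R)) :
  compact K -> (area R K < +oo)%E.
Proof.
move=> cK; have [M M0 KM] := compact_in_square cK.
have mI : measurable (`[-M, M] : set (measurableTypeR R)).
  exact: measurable_itv.
apply: (@le_lt_trans _ _ (area R (`[-M, M] `*` `[-M, M]))).
  apply: le_measure; rewrite ?inE//.
  - exact: compact_measurable_plane.
  - exact: measurableX.
  by move=> p /KM[p1 p2]; split=> /=; rewrite in_itv/= -ler_norml ltW.
have IE : (lebesgue_measure [set` `[(- M)%R, M]%R] < +oo)%E.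
  by rewrite lebesgue_measure_itv/=; case: ifP => _; rewrite -?EFinB ltry.
by rewrite /area/= product_measure1E// lte_mul_pinfty// ge0_fin_numE.
Qed.

Lemma continuous_integrable_plane (R : realType) (K : set (R * R))
    (f : R * R -> R) :
  compact K -> continuous f -> (area R).-integrable K (EFin \o f).
Proof.
move=> cK cf; apply: measurable_bounded_integrable.
- exact: compact_measurable_plane.
- exact: compact_area_lty.
- by apply: measurable_funTS; exact: continuous_measurable_plane.
- have /compact_bounded[M [Mr fM]] : compact (f @` K).
    by apply: continuous_compact => //; exact: continuous_subspaceT.
  by exists M; split => // x Mx p Kp /=; apply: fM => //; exists p.
Qed.

Lemma L2_continuous (R : realType) (K : set (R * R)) (f : R * R -> R) :
  compact K -> continuous f -> L2 K f.
Proof.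
move=> cK cf; rewrite /L2.
have mK := compact_measurable_plane cK.
have mfK : measurable_fun setT (f \_ K : mplane R -> measurableTypeR R).
  apply/(measurable_restrictT _ mK).
  by apply: measurable_funTS; exact: continuous_measurable_plane.
apply/andP; rewrite !inE /=; split; first exact: mfK.
rewrite /finite_norm unlock /=.
apply: poweR_lty.
have c2 : continuous (fun p => f p ^+ 2).
  by move=> p; rewrite /continuous_at !expr2; apply: cvgM; exact: cf.
have /integrableP[_] := continuous_integrable_plane cK c2.
rewrite integral_mkcond; apply: le_lt_trans.
rewrite le_eqVlt; apply/orP; left; apply/eqP; apply: eq_integral => p _.
rewrite /patch; case: ifP => _ /=; last by rewrite normr0 powR0.
by rewrite powR_mulrn// real_normK ?num_real// ger0_norm ?sqr_ge0.
Qed.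

(** ** Smooth functions and their weak derivatives *)

(** The two difference quotients are the same function of the increment. *)
Lemma derive_axis0 (R : realType) (f : R * R -> R) (x y : R) :
  'D_1 (fun t => f (t, y)) x = 'D_(axis R 0) f (x, y) /\
  (derivable f (x, y) (axis R 0) -> derivable (fun t => f (t, y)) x 1).
Proof.
have E : (fun h : R => h^-1 *: (f (h *: axis R 0 + (x, y)) - f (x, y))) =
         (fun h : R => h^-1 *: (f (h *: (1 : R) + x, y) - f (x, y))).
  apply/funext => h; congr (_ *: (f _ - _)).
  by rewrite /axis /=; congr (_, _); rewrite /= scaler0 add0r.
by rewrite /derivable /derive E.
Qed.

Lemma derive_axis1 (R : realType) (f : R * R -> R) (x y : R) :
  'D_1 (fun t => f (x, t)) y = 'D_(axis R 1) f (x, y) /\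
  (derivable f (x, y) (axis R 1) -> derivable (fun t => f (x, t)) y 1).
Proof.
have E : (fun h : R => h^-1 *: (f (h *: axis R 1 + (x, y)) - f (x, y))) =
         (fun h : R => h^-1 *: (f (x, h *: (1 : R) + y) - f (x, y))).
  apply/funext => h; congr (_ *: (f _ - _)).
  by rewrite /axis /=; congr (_, _); rewrite /= scaler0 add0r.
by rewrite /derivable /derive E.
Qed.

Lemma integral_derive_compact (R : realType) (M : R) (g dg : R -> R) :
  0 < M -> (forall x, derivable g x 1) -> (forall x, 'D_1 g x = dg x) ->
  continuous dg -> (forall x, M <= `|x| -> g x = 0 /\ dg x = 0) ->
  (\int[lebesgue_measure]_x (dg x)%:E = 0)%E.
Proof.
move=> M0 dg1 Dg cdg g0.
have cg : continuous g.
  by move=> x; apply/differentiable_continuous/derivable1_diffP.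
have E : (fun x => (dg x)%:E) = (EFin \o dg) \_ `[- M, M].
  apply/funext => x; rewrite patchE; case: ifPn => //.
  rewrite notin_setE/= in_itv/= -ler_norml => /negP; rewrite -ltNge => /ltW.
  by move/g0 => [_ ->].
rewrite E -integral_mkcond (@continuous_FTC2 _ dg g).
- have nM : M <= `|M| by exact: ler_norm.
  have nNM : M <= `|- M| by rewrite normrN.
  by rewrite (g0 _ nM).1 (g0 _ nNM).1 subee.
- by rewrite -subr_gt0 opprK addr_gt0.
- exact: continuous_subspaceT.
- split => //.
  + by apply: cvg_at_right_filter; exact: cg.
  + by apply: cvg_at_left_filter; exact: cg.
- by move=> x _; rewrite derive1E Dg.
Qed.

Lemma derive_off_support (R : realType) (S : set (R * R)) (w : R * R -> R)
    (v p : R * R) :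
  closed S -> (forall q, ~ S q -> w q = 0) -> ~ S p -> 'D_v w p = 0.
Proof.
move=> cS w0 Sp; rewrite (near_eq_derive (g := cst 0)); first exact: derive_cst.
have := closed_openC cS; rewrite openE => /(_ p Sp).
by apply: filterS => q /w0.
Qed.

(** By Fubini, integrate first along the axis [i]: on each line the integrand is
the derivative of a function that vanishes outside a fixed segment. *)
Lemma integral_partial_compact (R : realType) (S : set (R * R)) (i : 'I_2)
    (w : R * R -> R) :
  compact S -> (forall p, ~ S p -> w p = 0) ->
  (forall p, derivable w p (axis R i)) -> continuous ('D_(axis R i) w) ->
  \int[area R]_p 'D_(axis R i) w p = 0.
Proof.
move=> cS w0 dw cDw; have [M M0 SM] := compact_in_square cS.
have clS : closed S by exact: compact_closed (@norm_hausdorff _ _) cS.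
set D := 'D_(axis R i) w.
have D0 p : ~ S p -> D p = 0 by exact: derive_off_support.
have iD : (area R).-integrable setT (EFin \o D).
  have := continuous_integrable_plane cS cDw.
  move/(integrable_mkcond _ (compact_measurable_plane cS)).
  congr (integrable _ _ _); apply/funext => p; rewrite patchE; case: ifPn => //.
  by rewrite notin_setE => /D0 /= ->.
rewrite /Rintegral; suff -> : (\int[area R]_p (D p)%:E = 0)%E by [].
have far p : M <= `|p.1| \/ M <= `|p.2| -> w p = 0 /\ D p = 0.
  move=> Mp; suff Sp : ~ S p by rewrite w0 ?D0.
  by move=> /SM[]; rewrite !ltNge => /negP ? /negP ?; case: Mp.
case: i @D dw cDw D0 iD far => -[|[|//]] Hi.
- rewrite (_ : Ordinal Hi = 0) => [D dw cD D0 iD far|]; last exact: val_inj.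
  rewrite -(integral21_prod_meas1 iD); apply: integral0_eq => y _.
  rewrite /fubini_G /=.
  apply: (@integral_derive_compact _ M (fun t => w (t, y))) => //.
  + by move=> x; apply: (derive_axis0 w x y).2; exact: dw.
  + by move=> x; rewrite (derive_axis0 w x y).1.
  + move=> x; apply: (@continuous_comp _ _ _ (fun t => (t, y)) D); last exact: cD.
    exact: (cvg_pair cvg_id (cvg_cst y)).
  + by move=> x Mx; apply: far; left.
- rewrite (_ : Ordinal Hi = 1) => [D dw cD D0 iD far|]; last exact: val_inj.
  rewrite -(integral12_prod_meas1 iD); apply: integral0_eq => x _.
  rewrite /fubini_F /=.
  apply: (@integral_derive_compact _ M (fun t => w (x, t))) => //.
  + by move=> y; apply: (derive_axis1 w x y).2; exact: dw.
  + by move=> y; rewrite (derive_axis1 w x y).1.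
  + move=> y; apply: (@continuous_comp _ _ _ (fun t => (x, t)) D); last exact: cD.
    exact: (cvg_pair (cvg_cst x) cvg_id).
  + by move=> y My; apply: far; right.
Qed.

(** The product [f * phi] has its support in [S], so the integral over [K] of
its derivative is the integral over the plane, which vanishes. *)
Lemma Rintegral_by_parts (R : realType) (K S : set (R * R)) (i : 'I_2)
    (f phi : R * R -> R) :
  compact K -> compact S -> S `<=` K -> (forall p, ~ S p -> phi p = 0) ->
  smooth f -> smooth phi ->
  \int[area R]_(p in K) (f p * 'D_(axis R i) phi p) =
  - \int[area R]_(p in K) ('D_(axis R i) f p * phi p).
Proof.
move=> cK cS SK phi0 sf sphi.
have cM (g h : R * R -> R) : continuous g -> continuous h ->
    continuous (fun p => g p * h p).
  by move=> cg ch p; apply: cvgM; [exact: cg|exact: ch].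
have [cf df] := sf [::]; have [cphi dphi] := sphi [::].
have [cDf _] := sf [:: i]; have [cDphi _] := sphi [:: i].
have Dw : 'D_(axis R i) (f * phi) =
    (fun p => f p * 'D_(axis R i) phi p + 'D_(axis R i) f p * phi p).
  apply/funext => p; rewrite deriveM; [|exact: df|exact: dphi].
  by rewrite /GRing.scale/= [phi p * _]mulrC.
apply/eqP; rewrite -addr_eq0 -RintegralD; last 3 first.
- exact: compact_measurable_plane.
- by apply: continuous_integrable_plane => //; exact: cM.
- by apply: continuous_integrable_plane => //; exact: cM.
rewrite Rintegral_mkcond -Dw.
have clS : closed S by exact: compact_closed (@norm_hausdorff _ _) cS.
have w0 p : ~ S p -> (f * phi) p = 0.
  by move=> /phi0; rewrite /GRing.mul/= => ->; rewrite mulr0.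
have -> : 'D_(axis R i) (f * phi) \_ K = 'D_(axis R i) (f * phi).
  apply/funext => p; rewrite patchE; case: ifPn => //.
  rewrite notin_setE => Kp; apply/esym/(derive_off_support _ clS) => // /SK.
  exact: Kp.
apply/eqP/(integral_partial_compact cS) => //.
- by move=> p; apply: derivableM; [exact: df|exact: dphi].
- by rewrite Dw => p; apply: cvgD;
    [exact: (cM _ _ cf cDphi p)|exact: (cM _ _ cDf cphi p)].
Qed.

Lemma partial_cat (R : realType) (s t : seq 'I_2) (f : R * R -> R) :
  partial (s ++ t) f = partial s (partial t f).
Proof. by rewrite /partial foldr_cat. Qed.

Lemma smooth_partial (R : realType) (t : seq 'I_2) (f : R * R -> R) :
  smooth f -> smooth (partial t f).
Proof. by move=> sf s; rewrite -partial_cat; exact: sf. Qed.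

(** Integrating by parts moves the outermost derivative of the test function to
[f] first, hence the reversal of the word; equality of mixed derivatives is
thereby avoided. *)
Lemma smooth_weak_partial (R : realType) (K : set (R * R)) (s : seq 'I_2)
    (f : R * R -> R) :
  compact K -> smooth f -> weak_partial K s f (partial (rev s) f).
Proof.
move=> cK sf phi [sphi /=]; set S := closure _ => -[cS SK].
have phi0 t p : ~ S p -> partial t phi p = 0.
  elim: t p => [|i t IH] p Sp /=.
    by apply: contrapT => /eqP phip; apply: Sp; exact: subset_closure.
  by apply: (@derive_off_support _ S) => //; exact: closed_closure.
elim: s f sf => [|i s IH] f sf /=; first by rewrite expr0 mul1r.
rewrite (@Rintegral_by_parts _ K S)//.
- by rewrite (IH _ (smooth_partial [:: i] sf)) rev_cons
    -cats1 partial_cat exprS mulN1r mulNr.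
- exact: subset_trans SK (@interior_subset _ _).
- exact: phi0.
- exact: smooth_partial.
Qed.

(** ** Pointwise values and the essential supremum *)

(** If the essential supremum [e] were smaller, the set where [|f|] exceeds [e]
would be an open neighbourhood of [m], so it would meet [V] in a nonempty open
set; but a nonempty open set has positive area. *)
Lemma norm_oo_ge (R : realType) (K V : set (R * R)) (f : R * R -> R) m :
  open V -> V `<=` K -> closure V m -> continuous f ->
  (`|f m|%:E <= norm_oo K f)%E.
Proof.
move=> oV VK clV cf; rewrite /norm_oo unlock.
have open_gt0 U : open U -> U !=set0 -> (0 < area R U)%E.
  move=> oU [p Up]; move: (oU); rewrite openE => /(_ p Up)/nbhs_ballP[e /= e0 eU].
  pose I (x : R) : set R := [set` `]x - e, x + e[].
  have mI x : measurable (I x : set (measurableTypeR R)).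
    exact: measurable_itv.
  have I0 x : (0 < lebesgue_measure (I x))%E.
    by rewrite lebesgue_measure_itv/= lte_fin ifT -?EFinB ?lte_fin; lra.
  have box0 : (0 < area R (I p.1 `*` I p.2))%E.
    rewrite /area/= product_measure1E; [|exact: mI|exact: mI].
    by apply: mule_gt0; exact: I0.
  apply: lt_le_trans box0 _; apply: le_measure; rewrite ?inE//.
  - exact: measurableX.
  - exact: open_measurable_plane.
  move=> q []; rewrite /I /= !in_itv/= => /andP[x1 x2] /andP[y1 y2].
  by apply: eU; split => /=; rewrite /ball/= ltr_distlC; lra.
have V0 : V !=set0 by have [q []] := clV setT filterT; exists q.
rewrite (lt_le_trans (open_gt0 _ oV V0)); last first.
  apply: le_measure; rewrite ?inE//; exact: open_measurable_plane.
set e := ess_sup _ _; rewrite leNgt; apply/negP => em.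
pose W := [set p | (e < `|f p|%:E)%E].
have oW : open W.
  rewrite /W; case: e {W} em => [r _| |_]; last 2 first.
  - by rewrite ltNge leey.
  - have -> : [set p | (-oo < `|f p|%:E)%E] = setT; last exact: openT.
    by apply/seteqP; split => // p _ /=; rewrite ltNyr.
  apply: (@open_comp _ _ (fun p => `|f p|) [set x | r < x]); last first.
    exact: open_gt.
  by move=> p _; apply: cvg_norm; exact: cf.
pose U := V `&` W.
have oU : open U by exact: openI.
have U0 : U !=set0.
  have /clV[q Uq] : nbhs m W by exact: open_nbhs_nbhs.
  by exists q.
have := open_gt0 _ oU U0; suff -> : area R U = 0%E by rewrite ltxx.
apply/(measure_negligible (open_measurable_plane oU)).
have [N [mN N0 Ne]] := ess_sup_ge (area R) (abse \o (EFin \o f \_ K)).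
exists N; split => // p [Vp /= ep]; apply: Ne => /= pe.
move: ep; rewrite /W /= ltNge => /negP; apply; move: pe.
by rewrite patchE mem_set//; exact: VK.
Qed.

(** ** The triangle and its area *)

Lemma closed_ge0_continuous (R : realType) (f : R * R -> R) :
  continuous f -> closed [set p | 0 <= f p].
Proof.
move=> cf; apply: (@closed_comp _ _ f [set x | 0 <= x]); last exact: closed_ge.
by move=> p _; exact: cf.
Qed.

Lemma open_gt0_continuous (R : realType) (f : R * R -> R) :
  continuous f -> open [set p | 0 < f p].
Proof.
move=> cf; apply: (@open_comp _ _ f [set x | 0 < x]); last exact: open_gt.
by move=> p _; exact: cf.
Qed.

Lemma continuous_affine (R : realType) (a b c : R) :
  continuous (fun p : R * R => a + b * p.1 + c * p.2).
Proof.
move=> p; apply: cvgD; first (apply: cvgD; first exact: cvg_cst).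
- by apply: cvgM; [exact: cvg_cst|exact: cvg_fst].
- by apply: cvgM; [exact: cvg_cst|exact: cvg_snd].
Qed.

Section Triangle.
Context {R : realType} (alpha theta : R).
Let c := alpha * cos theta.
Let h := alpha * sin theta.
Hypothesis h0 : 0 < h.

(** Membership in terms of barycentric coordinates: the weights of the third,
second and first vertex are [p.2 / h], [(h * p.1 - c * p.2) / h] and the
complement to 1. *)
Lemma triangleE : triangle alpha theta =
  [set p | [/\ 0 <= p.2, 0 <= h * p.1 - c * p.2 & h * p.1 - c * p.2 + p.2 <= h]].
Proof.
apply/seteqP; split => [p [w [w0 w1 ->]]|[x y] /= [y0 x0 xy]].
  move: (w0 ord0) (w0 1) (w0 2) w1; rewrite !big_ord_recl !big_ord0 /=.
  rewrite (_ : lift ord0 ord0 = 1); last exact: val_inj.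
  rewrite (_ : lift ord0 (lift ord0 ord0) = 2); last exact: val_inj.
  rewrite /vertex /= -/c -/h => w0_ge0 w1_ge0 w2_ge0 sumw.
  rewrite /GRing.scale /= /GRing.scale /=.
  have hw1 : 0 <= h * w 1 by rewrite mulr_ge0// ltW.
  have hw2 : 0 <= h * w 2 by rewrite mulr_ge0// ltW.
  have hw : h * (w 1 + w 2) <= h by rewrite ger_pMr//; lra.
  by split; lra.
pose w3 := y / h; pose w2 := x - c * w3.
have w3h : w3 * h = y by rewrite /w3 divfK// gt_eqF.
exists (fun k => [:: 1 - w2 - w3; w2; w3]`_k); split.
- have w30 : 0 <= w3 by rewrite /w3 divr_ge0 // ltW.
  have w20 : 0 <= w2 by rewrite -(pmulr_rge0 _ h0) /w2; nra.
  have w10 : 0 <= 1 - w2 - w3 by rewrite -(pmulr_rge0 _ h0) /w2; nra.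
  by move=> -[[|[|[|//]]] ?] /=.
- by rewrite !big_ord_recl big_ord0 /=; ring.
- rewrite !big_ord_recl big_ord0 /= /vertex /= -/c -/h.
  congr (_, _); rewrite /= /GRing.scale/= /w2 -?w3h; ring.
Qed.

Lemma triangle_compact : compact (triangle alpha theta).
Proof.
rewrite triangleE -/c -/h.
apply: (@subclosed_compact _ _ (`[- (`|c| + 1), `|c| + 1] `*` `[0, h])).
- (* the three weights, times h, as affine functions *)
  pose F a b d := [set p : R * R | 0 <= a + b * p.1 + d * p.2].
  rewrite (_ : [set p | _] = F 0 0 1 `&` F 0 h (- c) `&` F h (- h) (c - 1)).
    by apply: closedI; first apply: closedI;
      apply: closed_ge0_continuous; exact: continuous_affine.
  apply/seteqP; split => [p []|p [[]]]; rewrite /F /= => *; split; try split; lra.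
- by apply: compact_setX; exact: segment_compact.
- move=> [x y] /= [y0 x0 xy]; split => /=; rewrite in_itv/=; last lra.
  have cy : - (`|c| * y) <= c * y <= `|c| * y.
    by rewrite -ler_norml normrM (ger0_norm y0).
  have hc : `|c| * y <= h * `|c| by rewrite mulrC ler_wpM2r//; lra.
  by apply/andP; split; rewrite -(ler_pM2l h0); lra.
Qed.

(** At height [y] the section is a segment that starts at [c * y / h] and has
length [1 - y / h]. *)
Lemma triangle_section y :
  lebesgue_measure [set x | triangle alpha theta (x, y)] =
  ((fun y => (1 - y / h)%:E) \_ `[0, h]) y.
Proof.
rewrite triangleE -/c -/h patchE; case: ifPn => [|].
  rewrite inE/= in_itv/= => /andP[y0 yh].
  have -> : [set x | [/\ 0 <= y, 0 <= h * x - c * y & h * x - c * y + y <= h]] =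
      [set` `[c * y / h, c * y / h + (1 - y / h)]].
    have E1 : c * y / h * h = c * y by rewrite divfK// gt_eqF.
    have E2 : y / h * h = y by rewrite divfK// gt_eqF.
    apply/seteqP; split => x /=; rewrite in_itv/=.
      by case=> *; apply/andP; split; rewrite -(ler_pM2r h0); lra.
    move=> /andP[]; rewrite -(ler_pM2r h0) => ?.
    by rewrite -(ler_pM2r h0) => ?; split => //; lra.
  rewrite lebesgue_measure_itv/= lte_fin; case: ifP => [_|/negbT].
    by rewrite -EFinB; congr EFin; ring.
  have : y / h <= 1 by rewrite ler_pdivrMr// mul1r.
  by move=> *; congr EFin; lra.
rewrite notin_setE/= in_itv/= => yh.
rewrite (_ : [set x | _] = set0) ?measure0//.
by apply/seteqP; split => // x /= [y0 ? ?]; apply: yh; lra.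
Qed.

Lemma triangle_area : area R (triangle alpha theta) = (h / 2)%:E.
Proof.
have mK := compact_measurable_plane triangle_compact.
rewrite -[X in area R X]setIT -integral_indic//.
rewrite /area fubini_tonelli2//=; last first.
  by apply/measurable_EFinP; exact: measurable_indic.
transitivity (\int[lebesgue_measure]_y
    (((fun y => (1 - y / h)%:E) \_ `[0%R, h]) y))%E.
  apply: eq_integral => y _; rewrite -triangle_section /fubini_G /=.
  have sectE : [set x | triangle alpha theta (x, y)] =
      ysection (triangle alpha theta) y.
    by apply/seteqP; split => x; rewrite /ysection /= in_setE.
  have mS : measurable ([set x | triangle alpha theta (x, y)] : set R).
    by rewrite sectE; exact: measurable_ysection.
  by rewrite -[X in lebesgue_measure X]setIT -integral_indic.
rewrite -integral_mkcond.
rewrite (@continuous_FTC2 _ (fun y => 1 - y / h) (fun y => y - y ^+ 2 / (2 * h)))//.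
- by rewrite -EFinB; congr EFin; field; rewrite gt_eqF.
- apply: continuous_subspaceT => y; apply: cvgB; first exact: cvg_cst.
  by apply: cvgM; [exact: cvg_id|exact: cvg_cst].
- have cF : continuous (fun y : R => y - y ^+ 2 / (2 * h)).
    move=> y; apply: cvgB; first exact: cvg_id.
    by apply: cvgM; [rewrite expr2; apply: cvgM; exact: cvg_id|exact: cvg_cst].
  split => //.
  + by apply: cvg_at_right_filter; exact: cF.
  + by apply: cvg_at_left_filter; exact: cF.
- move=> y _; rewrite derive1E.
  by rewrite derive_val /GRing.scale/=; field; rewrite gt_eqF.
Qed.
End Triangle.

(** ** The extremal candidate x^2 + y^2 *)

(** The span of 1, x, y and x^2 + y^2 is stable under partial derivatives, so
smoothness of its elements is proved for all of them at once. *)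
Definition quad (R : realType) (a b c d : R) (p : R * R) : R :=
  a + b * p.1 + c * p.2 + d * (p.1 ^+ 2 + p.2 ^+ 2).

Lemma is_derive_fst (R : realType) (p v : R * R) :
  is_derive p v (fst : R * R -> R) v.1.
Proof.
have cv : h^-1 *: ((h *: v + p).1 - p.1) @[h --> (0 : R)^'] --> v.1.
  apply: cvg_near_cst; near=> h.
  rewrite /= addrK scalerA mulVf ?scale1r//.
  by near: h; exact: nbhs_dnbhs_neq.
by apply: DeriveDef; [exact: cvgP cv|exact: cvg_lim cv].
Unshelve. all: by end_near. Qed.

Lemma is_derive_snd (R : realType) (p v : R * R) :
  is_derive p v (snd : R * R -> R) v.2.
Proof.
have cv : h^-1 *: ((h *: v + p).2 - p.2) @[h --> (0 : R)^'] --> v.2.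
  apply: cvg_near_cst; near=> h.
  rewrite /= addrK scalerA mulVf ?scale1r//.
  by near: h; exact: nbhs_dnbhs_neq.
by apply: DeriveDef; [exact: cvgP cv|exact: cvg_lim cv].
Unshelve. all: by end_near. Qed.

Lemma continuous_quad (R : realType) (a b c d : R) : continuous (quad a b c d).
Proof.
move=> p; apply: cvgD; first exact: continuous_affine.
have f2 : (fun p : R * R => p.1 ^+ 2) @ p --> p.1 ^+ 2.
  by rewrite !expr2; apply: cvgM; exact: cvg_fst.
have s2 : (fun p : R * R => p.2 ^+ 2) @ p --> p.2 ^+ 2.
  by rewrite !expr2; apply: cvgM; exact: cvg_snd.
by apply: cvgM; [exact: cvg_cst|exact: cvgD].
Qed.

Lemma is_derive_quad (R : realType) (a b c d : R) (p v : R * R) :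
  is_derive p v (quad a b c d)
    (quad (b * v.1 + c * v.2) (2 * d * v.1) (2 * d * v.2) 0 p).
Proof.
have df := is_derive_fst p v; have ds := is_derive_snd p v.
have D := is_deriveD (is_deriveD (is_deriveD (is_derive_cst a p v)
  (is_deriveZ b df)) (is_deriveZ c ds))
  (is_deriveZ d (is_deriveD (is_deriveX 2 df) (is_deriveX 2 ds))).
apply: (is_derive_eq D); rewrite /quad /GRing.scale /= expr1; ring.
Qed.

Lemma partial_quad (R : realType) (s : seq 'I_2) (a b c d : R) :
  exists a' b' c' d' : R, partial s (quad a b c d) = quad a' b' c' d'.
Proof.
elim: s => [|i s [a' [b' [c' [d' IH]]]]] /=; first by exists a, b, c, d.
rewrite IH; set v := axis R i.
exists (b' * v.1 + c' * v.2), (2 * d' * v.1), (2 * d' * v.2), 0.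
by apply/funext => p; have [_ ->] := is_derive_quad a' b' c' d' p v.
Qed.

Lemma smooth_quad (R : realType) (a b c d : R) : smooth (quad a b c d).
Proof.
move=> s; have [a' [b' [c' [d' ->]]]] := partial_quad s a b c d; split.
  exact: continuous_quad.
by move=> i p; have [] := is_derive_quad a' b' c' d' p (axis R i).
Qed.

Lemma partial2_normsq (R : realType) (i j : 'I_2) :
  partial [:: j; i] (quad 0 0 0 1) = cst (2 * (i == j)%:R) :> (R * R -> R).
Proof.
apply/funext => p /=.
rewrite (_ : 'D_(axis R i) (quad 0 0 0 1) =
    quad 0 (2 * (axis R i).1) (2 * (axis R i).2) 0); last first.
  apply/funext => q; have [_ ->] := is_derive_quad 0 0 0 1 q (axis R i).
  by rewrite !mul0r addr0 !mulr1.
have [_ ->] := is_derive_quad 0 (2 * (axis R i).1) (2 * (axis R i).2) 0 p (axis R j).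
rewrite /quad !mulr0 !mul0r !addr0 /axis /=.
by case: i => -[|[|//]] ?; case: j => -[|[|//]] ?; rewrite !eqE /= /eq_op /=; ring.
Qed.

(** ** The lower bound *)

Section LowerBound.
Context {R : realType} (alpha theta : R).
Let c := alpha * cos theta.
Let h := alpha * sin theta.
Hypothesis h0 : 0 < h.

(** As [h] is not zero, an affine interpolant exists, so the choice operator in
[interp] returns one. *)
Lemma interpP (u : R * R -> R) :
  affine_fun (interp alpha theta u) /\
  forall k, interp alpha theta u (vertex alpha theta k) = u (vertex alpha theta k).
Proof.
suff /(xgetPex point) : exists l, [set l | affine_fun l /\
    forall k, l (vertex alpha theta k) = u (vertex alpha theta k)] l by [].
pose b := u (1, 0) - u (0, 0).
exists (fun p => u (0, 0) + b * p.1 + ((u (c, h) - u (0, 0) - b * c) / h) * p.2).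
split; first by exists (u (0, 0)), b, ((u (c, h) - u (0, 0) - b * c) / h).
move=> -[[|[|[|//]]] Hk]; rewrite /vertex /=.
- by ring.
- by rewrite /b; ring.
- by rewrite -/c -/h; field; rewrite gt_eqF.
Qed.

(** The midpoint of the edge opposite to the origin, which is the longest edge
when [0 < alpha <= 1] and [cos theta <= alpha / 2]. *)
Definition midpoint : R * R := ((1 + c) / 2, h / 2).

(** Law of cosines. *)
Lemma edge_sq :
  1 + alpha ^+ 2 - 2 * alpha * cos theta = (1 - c) ^+ 2 + h ^+ 2.
Proof.
rewrite [in LHS](_ : alpha ^+ 2 = alpha ^+ 2 * (cos theta ^+ 2 + sin theta ^+ 2)).
  by rewrite /c /h; ring.
by rewrite cos2Dsin2 mulr1.
Qed.

Lemma interp_error_midpoint :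
  let u := quad 0 0 0 1 in
  u midpoint - interp alpha theta u midpoint =
  - ((1 + alpha ^+ 2 - 2 * alpha * cos theta) / 4).
Proof.
set u := quad 0 0 0 1 => /=.
have [[a0 [b0 [c0 l_affine]]] lv] := interpP u.
have := lv 1; have := lv 2.
rewrite !l_affine (_ : vertex alpha theta 1 = (1, 0))//
  (_ : vertex alpha theta 2 = (c, h))//.
rewrite /u /quad /midpoint /= => l2 l1.
by rewrite edge_sq; lra.
Qed.

Lemma seminorm2_normsq :
  seminorm2 (triangle alpha theta) (fun i j => cst (2 * (i == j)%:R)) =
  2 * Num.sqrt h.
Proof.
rewrite /seminorm2 (_ : (fun p => _) = cst 8); last first.
  apply/funext => p; rewrite !big_ord_recl !big_ord0 /=.
  by ring.
rewrite Rintegral_cst; last exact: compact_measurable_plane (triangle_compact h0).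
rewrite (triangle_area h0) /= (_ : 8 * (h / 2) = 2 ^+ 2 * h); last by field.
by rewrite sqrtrM ?sqr_ge0// sqrtr_sqr ger0_norm.
Qed.

Lemma strict_triangle_open :
  open [set p : R * R | [/\ 0 < p.2, 0 < h * p.1 - c * p.2 &
    h * p.1 - c * p.2 + p.2 < h]].
Proof.
pose F a b d := [set p : R * R | 0 < a + b * p.1 + d * p.2].
rewrite (_ : [set p | _] = F 0 0 1 `&` F 0 h (- c) `&` F h (- h) (c - 1)).
  by apply: openI; first apply: openI;
    apply: open_gt0_continuous; exact: continuous_affine.
by apply/seteqP; split => [p []|p [[]]]; rewrite /F /= => *; split; try split; lra.
Qed.

(** The points [(1 - t) * midpoint], for small positive [t], are interior and
tend to the midpoint. *)
Lemma midpoint_closure :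
  closure [set p : R * R | [/\ 0 < p.2, 0 < h * p.1 - c * p.2 &
    h * p.1 - c * p.2 + p.2 < h]] midpoint.
Proof.
move=> B Bm.
have cv : ((1 - t) * midpoint.1, (1 - t) * midpoint.2) @[t --> (0 : R)^'+]
    --> midpoint.
  have ct (x : R) : (1 - t) * x @[t --> (0 : R)^'+] --> x.
    have {2}-> : x = (1 - 0) * x by rewrite subr0 mul1r.
    apply: cvgM; last exact: cvg_cst.
    apply: cvgB; first exact: cvg_cst.
    exact/cvg_at_right_filter/cvg_id.
  exact: (cvg_pair (ct _) (ct _)).
near (0 : R)^'+ => t.
exists ((1 - t) * midpoint.1, (1 - t) * midpoint.2); split; last first.
  by near: t; exact: cv.
have t0 : 0 < t by [].
have ht : 0 < (1 - t) * h.
  rewrite mulr_gt0// subr_gt0; near: t; exact: nbhs_right_lt.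
have ht' : 0 < t * h by rewrite mulr_gt0.
by split; rewrite /midpoint /=; lra.
Unshelve. all: by end_near. Qed.

(** The quotient for x^2 + y^2 is bounded below by replacing the norm of the
error by its absolute value at the midpoint. *)
Lemma CL_ge :
  (((1 + alpha ^+ 2 - 2 * alpha * cos theta)
    / (8 * Num.sqrt (alpha * sin theta)))%:E <= CL alpha theta)%E.
Proof.
set K := triangle alpha theta; have cK : compact K := triangle_compact h0.
set u : R * R -> R := quad 0 0 0 1; have su : smooth u := smooth_quad 0 0 0 1.
(* the order of differentiation that smooth_weak_partial gives for the word ij *)
pose H i j : R * R -> R := partial [:: j; i] u.
have s0 : 0 < Num.sqrt h by rewrite sqrtr_gt0.
have semiE : seminorm2 K H = 2 * Num.sqrt h.
  rewrite -seminorm2_normsq; congr seminorm2.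
  by apply/funext => i; apply/funext => j; exact: partial2_normsq.
have Dsmooth s : L2 K (partial s u) by apply: L2_continuous => //; exact: (su s).1.
apply: le_trans (ereal_sup_ubound _); last first.
  exists u, H; split; last by [].
  - split; first exact: (Dsmooth [::]).
    by move=> s _; exists (partial (rev s) u) => //; exact: smooth_weak_partial.
  - by apply: continuous_subspaceT; exact: (su [::]).1.
  - move=> i j; split; first exact: Dsmooth.
    exact: (smooth_weak_partial [:: i; j]).
  - by rewrite semiE mulf_neq0// gt_eqF.
rewrite semiE inver gt_eqF ?mulr_gt0//.
rewrite (_ : _ / _ = `|u midpoint - interp alpha theta u midpoint|
    / (2 * Num.sqrt h)); last first.
  rewrite interp_error_midpoint normrN -/h ger0_norm.
    by field; rewrite gt_eqF.
  by rewrite edge_sq divr_ge0// addr_ge0 ?sqr_ge0.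
rewrite EFinM lee_wpmul2r ?lee_fin ?invr_ge0 ?mulr_ge0 ?(ltW s0)//.
have [[a0 [b0 [c0 l_affine]]] _] := interpP u.
apply: (@norm_oo_ge _ _ _ (u \- interp alpha theta u)%R _ _ _ midpoint_closure).
- exact: strict_triangle_open.
- move=> p [y0 x0 xy]; rewrite /K (triangleE h0) -/c -/h.
  by split; exact: ltW.
- move=> p; apply: cvgB; first exact: (su [::]).1.
  by rewrite (funext l_affine); exact: continuous_affine.
Qed.
End LowerBound.

(** ** Divergence of the constant *)

Lemma cvge_blowup (R : realType) (F : set_system R) {FF : Filter F}
    (s n : R -> R) (f : R -> \bar R) :
  s x @[x --> F] --> 0 -> (\forall x \near F, 0 < s x /\ 1 <= n x) ->
  (\forall x \near F, ((n x / (8 * s x))%:E <= f x)%E) ->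
  f x @[x --> F] --> +oo%E.
Proof.
move=> s0 sn nf; apply/cvgeyPge => A.
have B0 : 0 < 8 * (`|A| + 1) by rewrite mulr_gt0// ltr_wpDl.
have sB : \forall x \near F, s x < (8 * (`|A| + 1))^-1.
  by apply: cvgr_lt s0 _ _; rewrite invr_gt0.
near=> x.
have [sx nx] : 0 < s x /\ 1 <= n x by near: x.
apply: (@le_trans _ _ (n x / (8 * s x))%:E); last by near: x.
have sxB : s x < (8 * (`|A| + 1))^-1 by near: x.
rewrite lee_fin ler_pdivlMr ?mulr_gt0//; apply: le_trans nx.
apply: (@le_trans _ _ ((`|A| + 1) * (8 * s x))).
  by rewrite ler_pM2r ?mulr_gt0// ler_wpDr// ler_norm.
rewrite -(ltr_pM2r B0) mulVf ?gt_eqF// in sxB; lra.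
Unshelve. all: by end_near. Qed.

Theorem mainTheorem4 (R : realType) :
  (forall alpha : R, 0 < alpha <= 1 ->
     (exists2 theta0 : R, acos (alpha / 2) <= theta0 < pi &
      forall theta : R, theta0 < theta < pi ->
        (((1 + alpha ^+ 2 - 2 * alpha * cos theta)
            / (8 * Num.sqrt (alpha * sin theta)))%:E <= CL alpha theta)%E) /\
     CL alpha theta @[theta --> (pi : R)^'-] --> +oo%E) /\
  (forall alpha : R, 0 < alpha <= 1 ->
     (((alpha ^+ 2 + 1) / (8 * Num.sqrt alpha))%:E <= CL alpha (pi / 2))%E) /\
  CL alpha (pi / 2) @[alpha --> (0 : R)^'+] --> +oo%E.
Proof.
have CL_right (alpha : R) : 0 < alpha ->
    (((alpha ^+ 2 + 1) / (8 * Num.sqrt alpha))%:E <= CL alpha (pi / 2))%E.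
  move=> a0; have := @CL_ge _ alpha (pi / 2).
  by rewrite cos_pihalf sin_pihalf !mulr1 mulr0 subr0 addrC; apply.
split=> [alpha /andP[a0 a1]|]; last split=> [alpha /andP[a0 _]|].
- have CL_pi theta : 0 < theta < pi ->
      (((1 + alpha ^+ 2 - 2 * alpha * cos theta)
            / (8 * Num.sqrt (alpha * sin theta)))%:E <= CL alpha theta)%E.
    by move=> tpi; apply: CL_ge; rewrite mulr_gt0// sin_gt0_pi.
  split.
    exists (acos (alpha / 2)); first by rewrite lexx acos_ltpi//; lra.
    move=> theta /andP[t0 tpi]; apply: CL_pi; rewrite tpi andbT.
    by apply: le_lt_trans t0; apply: acos_ge0; lra.
  apply: (cvge_blowup (s := fun t => Num.sqrt (alpha * sin t))
    (n := fun t => 1 + alpha ^+ 2 - 2 * alpha * cos t)).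
  + apply: cvg_at_left_filter; rewrite -[X in _ --> X](@sqrtr0 R).
    rewrite -[X in Num.sqrt X](mulr0 alpha) -[X in alpha * X](@sinpi R).
    apply: continuous_cvg; first exact: sqrt_continuous.
    by apply: cvgM; [exact: cvg_cst|exact: continuous_sin].
  + near=> t.
    have tpi : 0 < t < pi.
      by apply/andP; split; near: t;
        [apply: nbhs_left_gt; exact: pi_gt0|exact: nbhs_left_lt].
    split; first by rewrite sqrtr_gt0 mulr_gt0// sin_gt0_pi.
    have ct : cos t < 0.
      near: t; apply: (@cvgr_lt _ _ _ _ _ (-1)); last by rewrite ltrN10.
      by apply: cvg_at_left_filter; rewrite -cospi; exact: continuous_cos.
    by rewrite -addrA lerDl; nra.
  + near=> t; apply: CL_pi.
    by apply/andP; split; near: t;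
        [apply: nbhs_left_gt; exact: pi_gt0|exact: nbhs_left_lt].
- exact: CL_right.
- apply: (cvge_blowup (s := fun a => Num.sqrt a) (n := fun a => a ^+ 2 + 1)).
  + by apply: cvg_at_right_filter; rewrite -{2}(@sqrtr0 R); exact: sqrt_continuous.
  + near=> a; have a0 : 0 < a by [].
    by rewrite sqrtr_gt0 a0 lerDr sqr_ge0.
  + by near=> a; apply: CL_right.
Unshelve. all: by end_near. Qed.
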